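(* Let $\mathbb{F}$ be a field of characteristic zero, let $W(2)$ be the conservative algebra over $\mathbb{F}$ of all multiplications on a $2$-dimensional vector space, let $W_2\subseteq W(2)$ be the subalgebra of all commutative multiplications, and let $S_2\subseteq W_2$ be the subalgebra of all commutative multiplications with zero multiplication trace. Then, for each algebra $\mathcal{A}\in\{S_2,W_2,W(2)\}$, every $2$-local automorphism $\Delta:\mathcal{A}\to\mathcal{A}$ is an automorphism of $\mathcal{A}$.
   Context: Let $V_2$ be a $2$-dimensional vector space over $\mathbb{F}$ with a basis $v_1,v_2$. The algebra $W(2)$ is the $8$-dimensional vector space of all multiplications on $V_2$, i.e. all bilinear maps $V_2\times V_2\to V_2$, with the (nonassociative) product $$(A\cdot B)(x,y)=A(v_1,B(x,y))-B(A(v_1,x),y)-B(x,A(v_1,y)),\qquad x,y\in V_2,\ A,B\in W(2).$$ For $i,j,k\in\{1,2\}$ let $\alpha^k_{ij}\in W(2)$ be given by $\alpha^k_{ij}(v_t,v_l)=\delta_{it}\delta_{jl}v_k$. The subalgebra $W_2\subseteq W(2)$ is the $6$-dimensional subspace of all commutative (symmetric) multiplications. The subalgebra $S_2\subseteq W_2$ is the $4$-dimensional subspace of commutative multiplications with zero multiplication trace (every left multiplication operator has trace zero); it has basis $$e_1=\alpha^1_{11}-\alpha^2_{12}-\alpha^2_{21},\quad e_2=\alpha^2_{11},\quad e_3=\alpha^2_{22}-\alpha^1_{12}-\alpha^1_{21},\quad e_4=\alpha^1_{22}.$$ For a (not necessarily associative) $\mathbb{F}$-algebra $\mathcal{A}$: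 a bijective linear map $\phi:\mathcal{A}\to\mathcal{A}$ is an automorphism if $\phi(xy)=\phi(x)\phi(y)$ for all $x,y\in\mathcal{A}$. A (not necessarily linear) map $\Delta:\mathcal{A}\to\mathcal{A}$ is a $2$-local automorphism if for any $x,y\in\mathcal{A}$ there exists an automorphism $\phi_{x,y}:\mathcal{A}\to\mathcal{A}$ such that $\Delta(x)=\phi_{x,y}(x)$ and $\Delta(y)=\phi_{x,y}(y)$. *)

(* Defs.v *)
From HB Require Import structures.
From mathcomp Require Import all_boot all_algebra.

Set Implicit Arguments.
Unset Strict Implicit.
Unset Printing Implicit Defensive.

Import GRing.Theory passmx.
Local Open Scope ring_scope.

(* mul is meant to be bilinear; associativity is not required. *)
Section NonassociativeAlgebra.
Variables (F : fieldType) (T : lmodType F) (mul : T -> T -> T).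

Definition is_automorphism (phi : T -> T) : Prop :=
  [/\ bijective phi, linear phi & {morph phi : x y / mul x y}].

Definition is_2local_automorphism (Delta : T -> T) : Prop :=
  forall x y : T, exists phi : T -> T,
    [/\ is_automorphism phi, Delta x = phi x & Delta y = phi y].

End NonassociativeAlgebra.

Section Subalgebra.
Variables (F : fieldType) (T : vectType F) (mul : T -> T -> T).
Variables (U : {vspace T}).
Hypothesis mulU : {in U &, forall A B, mul A B \in U}.

Definition subalg_mul (A B : subvs_of U) : subvs_of U :=
  Subvs (mulU (subvsP A) (subvsP B)).

End Subalgebra.

Section Trace.
Variables (F : fieldType) (V : vectType F).

(* The trace does not depend on the basis, see lfun_traceE. *)
Definition lfun_trace (f : 'End(V)) : F :=
  \tr (mxof (vbasis {:V}) (vbasis {:V}) f).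

Lemma lfun_traceE (e : (\dim {:V}).-tuple V) (f : 'End(V)) :
  basis_of {:V} e -> lfun_trace f = \sum_i coord e i (f e`_i).
Proof.
move=> eB; have bB := vbasisP {:V}; rewrite /lfun_trace.
rewrite -[f in LHS]comp_lfun1r (mxof_comp _ _ eB).
rewrite mxtrace_mulC -(mxof_comp _ _ bB) comp_lfun1l.
by apply: eq_bigr => i _; rewrite !mxE vecof_delta.
Qed.

Fact lfun_trace_is_linear : scalar lfun_trace.
Proof. by move=> a f g; rewrite /lfun_trace !linearP. Qed.
HB.instance Definition _ :=
  GRing.isLinear.Build F 'End(V) F *%R lfun_trace lfun_trace_is_linear.

Lemma lfun_traceC (f g : 'End(V)) :
  lfun_trace (f \o g)%VF = lfun_trace (g \o f)%VF.
Proof. by rewrite /lfun_trace !(mxof_comp _ _ (vbasisP _)) mxtrace_mulC. Qed.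

End Trace.

(* Bilinear maps V x V -> V in curried form: A(x, y) is A x y, and the left
   multiplication operator y |-> A(x, y) is the endomorphism A x. *)
Notation mults V := 'Hom(V, 'End(V)).

Section Multiplications.
Variables (F : fieldType) (V : vectType F).
Implicit Types (A B : mults V) (x y : V).

Section Product.
Variable v1 : V.

Definition mults_mul_fun A B x : 'End(V) :=
  (A v1 \o B x)%VF - B (A v1 x) - (B x \o A v1)%VF.

Lemma mults_mul_funE A B x y :
  mults_mul_fun A B x y = A v1 (B x y) - B (A v1 x) y - B x (A v1 y).
Proof. by rewrite /mults_mul_fun !lfun_simp. Qed.

Fact mults_mul_fun_is_linear A B : linear (mults_mul_fun A B).
Proof.
move=> a x y; apply/lfunP => z.
rewrite [RHS]add_lfunE scale_lfunE !mults_mul_funE !linearP.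
rewrite !add_lfunE !scale_lfunE.
rewrite linearP /= !scalerBr !opprD [RHS]addrACA.
by congr (_ + _); rewrite addrACA.
Qed.
HB.instance Definition _ A B :=
  GRing.isLinear.Build F V 'End(V) *:%R (mults_mul_fun A B)
    (mults_mul_fun_is_linear A B).

Definition mults_mul A B : mults V := linfun (mults_mul_fun A B).

Lemma mults_mulE A B x y :
  mults_mul A B x y = A v1 (B x y) - B (A v1 x) y - B x (A v1 y).
Proof. by rewrite lfunE /= mults_mul_funE. Qed.

End Product.

Definition swap_mult_fun A x : V -> V := fun y => A y x.
Fact swap_mult_fun_is_linear A x : linear (swap_mult_fun A x).
Proof. by move=> a y z; rewrite /swap_mult_fun linearP !lfunE /= lfunE. Qed.
HB.instance Definition _ A x :=
  GRing.isLinear.Build F V V *:%R (swap_mult_fun A x)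
    (swap_mult_fun_is_linear A x).

Definition swap_mult_lfun A x : 'End(V) := linfun (swap_mult_fun A x).
Fact swap_mult_lfun_is_linear A : linear (swap_mult_lfun A).
Proof.
move=> a x y; apply/lfunP => z; rewrite add_lfunE scale_lfunE.
by rewrite !lfunE /= /swap_mult_fun linearP.
Qed.
HB.instance Definition _ A :=
  GRing.isLinear.Build F V 'End(V) *:%R (swap_mult_lfun A)
    (swap_mult_lfun_is_linear A).

Definition swap_mult A : mults V := linfun (swap_mult_lfun A).

Lemma swap_multE A x y : swap_mult A x y = A y x.
Proof. by rewrite !lfunE. Qed.

Fact swap_mult_is_linear : linear swap_mult.
Proof.
move=> a A B; apply/lfunP => x; apply/lfunP => y.
rewrite swap_multE (add_lfunE _ _ y) (scale_lfunE _ _ y) (add_lfunE _ _ x).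
rewrite (scale_lfunE _ _ x) (add_lfunE _ _ x) (scale_lfunE _ _ x).
by rewrite (add_lfunE _ _ y) (scale_lfunE _ _ y) !swap_multE.
Qed.
HB.instance Definition _ :=
  GRing.isLinear.Build F (mults V) (mults V) *:%R swap_mult
    swap_mult_is_linear.

Definition comm_mults : {vspace mults V} := fixedSpace (linfun swap_mult).

Lemma comm_multsP A :
  reflect (forall x y, A x y = A y x) (A \in comm_mults).
Proof.
apply: (iffP fixedSpaceP) => [E x y | E]; last first.
  by apply/lfunP => x; apply/lfunP => y; rewrite lfunE /= swap_multE.
by rewrite -[in LHS]E lfunE /= swap_multE.
Qed.

Definition mult_trace_fun A x : F^o := lfun_trace (A x).
Fact mult_trace_fun_is_linear A : linear (mult_trace_fun A).
Proof. by move=> a x y; rewrite /mult_trace_fun !linearP. Qed.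
HB.instance Definition _ A :=
  GRing.isLinear.Build F V F^o *:%R (mult_trace_fun A)
    (mult_trace_fun_is_linear A).

Definition mult_trace A : 'Hom(V, F^o) := linfun (mult_trace_fun A).
Fact mult_trace_is_linear : linear mult_trace.
Proof.
move=> a A B; apply/lfunP => x.
by rewrite !(lfunE, lfun_simp) /= /mult_trace_fun !lfun_simp linearP.
Qed.
HB.instance Definition _ :=
  GRing.isLinear.Build F (mults V) 'Hom(V, F^o) *:%R mult_trace
    mult_trace_is_linear.

Definition comm_trace0_mults : {vspace mults V} :=
  (comm_mults :&: lker (linfun mult_trace))%VS.

Lemma comm_trace0_multsP A :
  reflect ((forall x y, A x y = A y x) /\ (forall x, lfun_trace (A x) = 0))
          (A \in comm_trace0_mults).
Proof.
rewrite memv_cap memv_ker lfunE /=.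
apply: (iffP andP) => -[/comm_multsP cA tA]; split=> //.
  by move=> x; have /lfunP/(_ x) := eqP tA; rewrite !lfunE.
by apply/eqP/lfunP => x; rewrite !lfunE; apply: tA.
Qed.

Variable v1 : V.

Lemma comm_mults_mul_closed :
  {in comm_mults &, forall A B, mults_mul v1 A B \in comm_mults}.
Proof.
move=> A B _ /comm_multsP cB; apply/comm_multsP => x y; rewrite !mults_mulE.
by rewrite (cB x y) (cB _ y) (cB x) -!addrA [- _ - _]addrC.
Qed.

Lemma comm_trace0_mults_mul_closed :
  {in comm_trace0_mults &, forall A B, mults_mul v1 A B \in comm_trace0_mults}.
Proof.
move=> A B /comm_trace0_multsP[cA tA] /comm_trace0_multsP[cB tB].
apply/comm_trace0_multsP; split.
  by apply/comm_multsP/comm_mults_mul_closed; apply/comm_multsP.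
move=> x; rewrite /mults_mul lfunE /= !linearB /= tB subr0.
by rewrite lfun_traceC subrr.
Qed.

Definition comm_mults_mul := subalg_mul comm_mults_mul_closed.
Definition comm_trace0_mults_mul := subalg_mul comm_trace0_mults_mul_closed.

End Multiplications.

Notation comm_mults_alg V := (subvs_of (comm_mults V)).
Notation comm_trace0_mults_alg V := (subvs_of (comm_trace0_mults V)).

(* Main.v *)
Require Import Defs.
From HB Require Import structures.
From mathcomp Require Import all_boot all_algebra.
From mathcomp Require Import ring.

Import GRing.Theory.
Local Open Scope ring_scope.

(* Each of the three algebras is generated by a single element X.  Hence an
   automorphism is determined by its value at X: if a 2-local automorphism
   Delta agrees with the automorphism psi at X, then for every Y the
   automorphism that agrees with Delta at X and Y is psi, so Delta = psi. *)

(** * Algebras generated by one element *)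

Section Generation.
Context {F : fieldType} {T : vectType F}.
Implicit Types (mul : T -> T -> T) (P : T -> Prop) (X : T) (U : {vspace T}).

Definition subalg_closed mul P : Prop :=
  (forall k A B, P A -> P B -> P (k *: A + B)) /\
  (forall A B, P A -> P B -> P (mul A B)).

(** Impredicative form of the inclusion of [U] in the subalgebra generated by [X]. The converse
    inclusion is not asserted, so [X \in U] is a separate premise below. *)
Definition generates mul X U : Prop :=
  forall P, subalg_closed mul P -> P X -> forall A, A \in U -> P A.

(** Closure is stated for [k *: A + B], so iterated linear combinations need 0 as their last
    term. *)
Lemma subalg_closed0 mul P X : subalg_closed mul P -> P X -> P 0.
Proof. by move=> [lP _] PX; rewrite -(subrr X) addrC -scaleN1r; apply: lP. Qed.

Lemma generated_2local_automorphism mul X (Delta : T -> T) :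
  generates mul X {:T} ->
  is_2local_automorphism mul Delta -> is_automorphism mul Delta.
Proof.
move=> genX locD; have [psi [[psi_bij psi_lin psi_mul] DX _]] := locD X X.
have eqD : psi =1 Delta.
  move=> Y; have [phi [[_ phi_lin phi_mul] DX' ->]] := locD X Y.
  (* The equalizer of two automorphisms is a subalgebra, and it contains [X] since both send [X] to
     [Delta X]. *)
  apply: (genX (fun A => psi A = phi A)); last exact: memvf.
    split=> [k A B eA eB | A B eA eB].
      by rewrite psi_lin phi_lin eA eB.
    by rewrite psi_mul phi_mul eA eB.
  by rewrite -DX -DX'.
split; first exact: eq_bij psi_bij _ eqD.
- by move=> k A B; rewrite -!eqD psi_lin.
- by move=> A B; rewrite -!eqD psi_mul.
Qed.

End Generation.

Lemma subalg_2local_automorphism {F : fieldType} {T : vectType F}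
    (mul : T -> T -> T) (U : {vspace T}) (X : T)
    (mulU : {in U &, forall A B, mul A B \in U})
    (Delta : subvs_of U -> subvs_of U) :
  X \in U -> generates mul X U ->
  is_2local_automorphism (subalg_mul mulU) Delta ->
  is_automorphism (subalg_mul mulU) Delta.
Proof.
move=> XU genX; apply: (generated_2local_automorphism _ (Subvs XU)).
move=> P [linP mulP] PX A _.
(* [P] lives on the subtype, while generation is known in [T]; the image of [P] under [vsval] is a
   closed predicate on [T]. *)
have [B /val_inj <- //] : exists2 B, vsval B = vsval A & P B.
apply: (genX (fun C => exists2 B, vsval B = C & P B)); last exact: subvsP.
  split=> [k _ _ [B <- PB] [C <- PC] | _ _ [B <- PB] [C <- PC]].
    by exists (k *: B + C); [rewrite linearP | exact: linP].
  by exists (subalg_mul mulU B C); last exact: mulP.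
by exists (Subvs XU).
Qed.

(** * Structure constants in the basis [v1], [v2] *)

Section Coordinates.
Context {F : fieldType} {V : vectType F} {v1 v2 : V}.
Hypothesis v_basis : basis_of {:V} [:: v1; v2].
Implicit Types W : vectType F.

Let e : 2.-tuple V := [tuple v1; v2].

Let free_e : free e.
Proof. exact: basis_free v_basis. Qed.

Lemma coord_v i : (coord e i v1 = (i == 0)%:R) * (coord e i v2 = (i == 1)%:R).
Proof.
by split; rewrite eq_sym;
  [apply: (coord_free (X := e) 0) | apply: (coord_free (X := e) 1)].
Qed.

Lemma basis_decomp x : x = coord e 0 x *: v1 + coord e 1 x *: v2.
Proof.
rewrite [LHS](coord_basis (X := e) v_basis (memvf x)) big_ord_recl big_ord1.
(* The second index is [lift ord0 ord0], which has the same value as 1. *)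
by congr (_ + coord e _ x *: _); apply: val_inj.
Qed.

Lemma coord_inj x y :
  coord e 0 x = coord e 0 y -> coord e 1 x = coord e 1 y -> x = y.
Proof. by move=> e0 e1; rewrite (basis_decomp x) e0 e1 -basis_decomp. Qed.

Lemma basis_ext W (f g : 'Hom(V, W)) : f v1 = g v1 -> f v2 = g v2 -> f = g.
Proof.
move=> e1 e2; apply/lfunP => x.
by rewrite (basis_decomp x) !linearD !linearZ /= e1 e2.
Qed.

Definition hom_fun {W} (w1 w2 : W) x : W :=
  coord e 0 x *: w1 + coord e 1 x *: w2.

Fact hom_fun_is_linear W (w1 w2 : W) : linear (hom_fun w1 w2).
Proof.
move=> k x y; rewrite /hom_fun (linearP (coord e 0)) (linearP (coord e 1)).
by rewrite !scalerDl -!scalerA scalerDr addrACA.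
Qed.
HB.instance Definition _ W (w1 w2 : W) :=
  GRing.isLinear.Build F V W *:%R (hom_fun w1 w2) (hom_fun_is_linear W w1 w2).

Definition hom {W} (w1 w2 : W) : 'Hom(V, W) := linfun (hom_fun w1 w2).

Lemma homE1 W (w1 w2 : W) : hom w1 w2 v1 = w1.
Proof. by rewrite lfunE /= /hom_fun !coord_v scale1r scale0r addr0. Qed.

Lemma homE2 W (w1 w2 : W) : hom w1 w2 v2 = w2.
Proof. by rewrite lfunE /= /hom_fun !coord_v scale1r scale0r add0r. Qed.

(** The pairs (a, b), (c, d), (p, q), (r, s) are the coordinates of the products v1 v1, v1 v2, v2
    v1, v2 v2. *)
Definition mult (a b c d p q r s : F) : mults V :=
  hom (hom (a *: v1 + b *: v2) (c *: v1 + d *: v2))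
      (hom (p *: v1 + q *: v2) (r *: v1 + s *: v2)).

Lemma eq_mult a b c d p q r s a' b' c' d' p' q' r' s' :
  a = a' -> b = b' -> c = c' -> d = d' ->
  p = p' -> q = q' -> r = r' -> s = s' ->
  mult a b c d p q r s = mult a' b' c' d' p' q' r' s'.
Proof. by do 8 move=> ->. Qed.

Lemma mult_ext (A B : mults V) :
  A v1 v1 = B v1 v1 -> A v1 v2 = B v1 v2 ->
  A v2 v1 = B v2 v1 -> A v2 v2 = B v2 v2 -> A = B.
Proof. by move=> *; apply: basis_ext; apply: basis_ext. Qed.

Lemma multP (A : mults V) :
  exists a b c d p q r s, A = mult a b c d p q r s.
Proof.
exists (coord e 0 (A v1 v1)), (coord e 1 (A v1 v1)),
  (coord e 0 (A v1 v2)), (coord e 1 (A v1 v2)),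
  (coord e 0 (A v2 v1)), (coord e 1 (A v2 v1)),
  (coord e 0 (A v2 v2)), (coord e 1 (A v2 v2)).
by apply: mult_ext; rewrite /mult !(homE1, homE2) -basis_decomp.
Qed.

Lemma mult_lin k a b c d p q r s a' b' c' d' p' q' r' s' :
  k *: mult a b c d p q r s + mult a' b' c' d' p' q' r' s' =
  mult (k * a + a') (k * b + b') (k * c + c') (k * d + d')
       (k * p + p') (k * q + q') (k * r + r') (k * s + s').
Proof.
apply: mult_ext; rewrite !add_lfunE !scale_lfunE /mult !(homE1, homE2);
  by rewrite scalerDr !scalerA !scalerDl addrACA.
Qed.

Lemma mult0 : 0 = mult 0 0 0 0 0 0 0 0.
Proof.
apply: mult_ext; rewrite !zero_lfunE /mult !(homE1, homE2);
  by rewrite !scale0r addr0.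
Qed.

(** Reduces each explicit product in the generation proofs to eight scalar identities for [ring]. *)
Lemma mult_mul a b c d p q r s a' b' c' d' p' q' r' s' :
  mults_mul v1 (mult a b c d p q r s) (mult a' b' c' d' p' q' r' s') =
  mult (a' * a + b' * c - (a * a' + b * p') - (a * a' + b * c'))
       (a' * b + b' * d - (a * b' + b * q') - (a * b' + b * d'))
       (c' * a + d' * c - (a * c' + b * r') - (c * a' + d * c'))
       (c' * b + d' * d - (a * d' + b * s') - (c * b' + d * d'))
       (p' * a + q' * c - (c * a' + d * p') - (a * p' + b * r'))
       (p' * b + q' * d - (c * b' + d * q') - (a * q' + b * s'))
       (r' * a + s' * c - (c * c' + d * r') - (c * p' + d * r'))
       (r' * b + s' * d - (c * d' + d * s') - (c * q' + d * s')).
Proof.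
by apply: mult_ext; rewrite !mults_mulE /mult !(homE1, homE2)
  ?linearD ?linearZ /= ?(add_lfunE, scale_lfunE) ?(homE1, homE2)
  ?linearD ?linearZ /= ?(add_lfunE, scale_lfunE) ?(homE1, homE2);
  apply: coord_inj;
  rewrite !(linearD, linearZ, linearN) /= !coord_v /=; ring.
Qed.

Lemma coord_lin i a b : coord e i (a *: v1 + b *: v2) = if i == 0 then a else b.
Proof.
rewrite linearD !linearZ /= !coord_v.
by case: i => [[|[|//]] ?] /=; rewrite ?mulr1 ?mulr0 ?addr0 ?add0r.
Qed.

Lemma mult_comm a b c d p q r s :
  (mult a b c d p q r s \in comm_mults V) = (c == p) && (d == q).
Proof.
apply/comm_multsP/andP => [/(_ v1 v2) | [/eqP-> /eqP->] x y].
  rewrite /mult !(homE1, homE2) => E.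
  have := congr1 (coord e 0) E; have := congr1 (coord e 1) E.
  by rewrite !coord_lin /= => -> ->.
(* Stated as an equality of bilinear maps, symmetry needs checking on basis vectors only. *)
set A := mult _ _ _ _ _ _ _ _; have EA : swap_mult A = A.
  by apply: mult_ext; rewrite swap_multE /A /mult !(homE1, homE2).
by rewrite -[in LHS]EA swap_multE.
Qed.

Lemma lfun_trace_basis2 (f : 'End(V)) :
  lfun_trace f = coord e 0 (f v1) + coord e 1 (f v2).
Proof.
(* [lfun_traceE] wants a tuple of length [\dim {:V}], equal to 2 only propositionally; a variable
   length [n] lets that equality be eliminated. *)
have trE n (b : n.-tuple V) : basis_of {:V} b ->
    lfun_trace f = \sum_i coord b i (f b`_i).
  move=> bB; have dimV : \dim {:V} = n by rewrite (size_basis bB).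
  by case: _ / dimV in b bB *; apply: lfun_traceE.
rewrite (trE _ e v_basis) big_ord_recl big_ord1.
by congr (_ + coord e _ _); apply: val_inj.
Qed.

Lemma mult_comm_trace0 a b c d p q r s :
  (mult a b c d p q r s \in comm_trace0_mults V) =
  [&& c == p, d == q, a + d == 0 & p + s == 0].
Proof.
(* Left multiplications by [v1] and [v2] have traces a + d and p + s. *)
have tr x : lfun_trace (mult a b c d p q r s x) =
    coord e 0 x * (a + d) + coord e 1 x * (p + s).
  rewrite {1}(basis_decomp x) linearD !linearZ lfun_trace_basis2 /=.
  rewrite !(add_lfunE, scale_lfunE) /mult !(homE1, homE2).
  by rewrite !linearD !linearZ /= !coord_v /=; ring.
apply/comm_trace0_multsP/and4P => [[/comm_multsP]|].
  rewrite mult_comm => /andP[-> ->] tr0; split=> //.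
    by have := tr0 v1; rewrite tr !coord_v /= mul1r mul0r addr0 => ->.
  by have := tr0 v2; rewrite tr !coord_v /= mul1r mul0r add0r => ->.
move=> [cp dq /eqP t1 /eqP t2]; split=> [|x].
  by apply/comm_multsP; rewrite mult_comm cp.
by rewrite tr t1 t2 !mulr0 addr0.
Qed.

(** * Single generators in characteristic zero *)

Hypothesis charF : [pchar F] =i pred0.

Let natF_neq0 n : n.+1%:R != 0 :> F.
Proof. by rewrite ((pcharf0P F).1 charF). Qed.

(* The generators below and the products that complete them to bases were
   found by a search over small integer coefficients; the determinants of
   these bases are, up to sign, powers of 2 and 3. *)
Lemma comm_trace0_mults_generated :
  generates (mults_mul v1) (mult 0 1 0 0 0 0 1 0) (comm_trace0_mults V).
Proof.
move=> P closedP PX A; have P0 := subalg_closed0 _ _ _ closedP PX.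
(* In the standard basis of this algebra X = e2 + e4, and the products below are X X = e3, e3 X = -
   e1 and X (- e1) = - 3 e2. *)
have [linP mulP] := closedP; have PE B C : B = C -> P B -> P C by move=> ->.
have P1 : P (mult 0 0 (-1) 0 (-1) 0 0 1).
  by apply: PE (mulP _ _ PX PX); rewrite mult_mul; apply: eq_mult; ring.
have P2 : P (mult (-1) 0 0 1 0 1 0 0).
  by apply: PE (mulP _ _ P1 PX); rewrite mult_mul; apply: eq_mult; ring.
have P3 : P (mult 0 (-3) 0 0 0 0 0 0).
  by apply: PE (mulP _ _ PX P2); rewrite mult_mul; apply: eq_mult; ring.
have [a [b [c [d [p [q [r [s ->]]]]]]]] := multP A.
(* Commuting the second sum makes s, not p, the entry to eliminate; b, c, d, r stay free. *)
rewrite mult_comm_trace0 addr_eq0 addrC addr_eq0.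
case/and4P => /eqP<- /eqP<- /eqP-> /eqP->.
apply: PE (linP r _ _ PX
    (linP (- c) _ _ P1
    (linP d _ _ P2
    (linP ((r - b) / 3) _ _ P3 P0)))).
by rewrite mult0 !mult_lin; apply: eq_mult; field; rewrite ?natF_neq0.
Qed.

Lemma comm_mults_generated :
  generates (mults_mul v1) (mult 0 (-1) (-1) 0 (-1) 0 0 0) (comm_mults V).
Proof.
move=> P closedP PX A; have P0 := subalg_closed0 _ _ _ closedP PX.
have [linP mulP] := closedP; have PE B C : B = C -> P B -> P C by move=> ->.
have P1 : P (mult (-1) 0 0 0 0 0 (-2) 0).
  by apply: PE (mulP _ _ PX PX); rewrite mult_mul; apply: eq_mult; ring.
have P2 : P (mult 0 (-2) 0 0 0 0 0 0).
  by apply: PE (mulP _ _ P1 PX); rewrite mult_mul; apply: eq_mult; ring.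
have P3 : P (mult (-1) 0 0 0 0 0 2 0).
  by apply: PE (mulP _ _ P1 P1); rewrite mult_mul; apply: eq_mult; ring.
have P4 : P (mult 0 1 1 0 1 0 0 (-2)).
  by apply: PE (mulP _ _ PX P3); rewrite mult_mul; apply: eq_mult; ring.
have P5 : P (mult 2 0 0 (-2) 0 (-2) 0 0).
  by apply: PE (mulP _ _ PX P2); rewrite mult_mul; apply: eq_mult; ring.
have [a [b [c [d [p [q [r [s ->]]]]]]]] := multP A.
rewrite mult_comm => /andP[/eqP<- /eqP<-].
(* Only [P4] involves s and only [P5] involves d, which fixes their coefficients; then c gives that
   of [X], b that of [P2], and a, r together those of [P1] and [P3]. *)
apply: PE (linP (- c - s / 2) _ _ PX
    (linP (- (a + d) / 2 - r / 4) _ _ P1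
    (linP ((c - b) / 2) _ _ P2
    (linP (- (a + d) / 2 + r / 4) _ _ P3
    (linP (- s / 2) _ _ P4
    (linP (- d / 2) _ _ P5 P0)))))).
by rewrite mult0 !mult_lin; apply: eq_mult; field; rewrite ?natF_neq0.
Qed.

Lemma mults_generated :
  generates (mults_mul v1) (mult 0 (-1) 1 (-1) 0 0 0 1) {:mults V}.
Proof.
move=> P closedP PX A; have P0 := subalg_closed0 _ _ _ closedP PX.
have [linP mulP] := closedP; have PE B C : B = C -> P B -> P C by move=> ->.
have P1 : P (mult 0 0 0 1 0 2 0 2).
  by apply: PE (mulP _ _ PX PX); rewrite mult_mul; apply: eq_mult; ring.
have P2 : P (mult 0 0 0 0 0 0 0 (-2)).
  by apply: PE (mulP _ _ P1 P1); rewrite mult_mul; apply: eq_mult; ring.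
have P3 : P (mult 0 (-1) (-1) 0 0 0 0 (-1)).
  by apply: PE (mulP _ _ P1 PX); rewrite mult_mul; apply: eq_mult; ring.
have P4 : P (mult 0 (-1) 1 0 0 0 0 1).
  by apply: PE (mulP _ _ P1 P3); rewrite mult_mul; apply: eq_mult; ring.
have P5 : P (mult 2 0 0 (-1) 0 0 0 0).
  by apply: PE (mulP _ _ P3 P4); rewrite mult_mul; apply: eq_mult; ring.
have P6 : P (mult 0 0 0 (-2) 0 (-2) 2 0).
  by apply: PE (mulP _ _ P3 P2); rewrite mult_mul; apply: eq_mult; ring.
have P7 : P (mult 0 (-3) (-3) 0 (-2) 0 0 1).
  by apply: PE (mulP _ _ PX P5); rewrite mult_mul; apply: eq_mult; ring.
have [a [b [c [d [p [q [r [s ->]]]]]]]] := multP A => _.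
(* The entries a, p, r occur only in [P5], [P7], [P6] respectively; then q gives the coefficient of
   [P1], d that of [X], b and c those of [P3] and [P4], and s that of [P2]. *)
apply: PE (linP ((q - a - r) / 2 - d) _ _ PX
    (linP ((q + r) / 2) _ _ P1
    (linP ((c + q + r - s) / 2 - p) _ _ P2
    (linP ((3 * p - b - c) / 2) _ _ P3
    (linP ((a - b + c - q + r) / 2 + d) _ _ P4
    (linP (a / 2) _ _ P5
    (linP (r / 2) _ _ P6
    (linP (- p / 2) _ _ P7 P0)))))))).
by rewrite mult0 !mult_lin; apply: eq_mult; field; rewrite ?natF_neq0.
Qed.

End Coordinates.

Theorem theorem5p1 (F : fieldType) (charF : [pchar F] =i pred0)
    (V : vectType F) (v1 v2 : V) (v_basis : basis_of {:V} [:: v1; v2]) :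
  [/\ forall Delta : comm_trace0_mults_alg V -> comm_trace0_mults_alg V,
        is_2local_automorphism (comm_trace0_mults_mul v1) Delta ->
        is_automorphism (comm_trace0_mults_mul v1) Delta,
      forall Delta : comm_mults_alg V -> comm_mults_alg V,
        is_2local_automorphism (comm_mults_mul v1) Delta ->
        is_automorphism (comm_mults_mul v1) Delta
    & forall Delta : mults V -> mults V,
        is_2local_automorphism (mults_mul v1) Delta ->
        is_automorphism (mults_mul v1) Delta].
Proof.
split=> Delta.
- apply: subalg_2local_automorphism (comm_trace0_mults_generated v_basis charF).
  (* What remains is that the generator lies in the subspace. *)
  by rewrite (mult_comm_trace0 v_basis) !addr0 !eqxx.
- apply: subalg_2local_automorphism (comm_mults_generated v_basis charF).
  by rewrite (mult_comm v_basis) !eqxx.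
- exact: generated_2local_automorphism (mults_generated v_basis charF).
Qed.
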